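(* Let $\phi_1(x)\equiv 1$, let $f_d^*\in\operatorname{argmin}_{f\in\mathcal M_d}L(f)$, and assume that the vector $(y_1-f_d^*(x_1),\dots,y_n-f_d^*(x_n))$ and the matrix $\Phi$ are statistically independent. Let $\widehat R_D(d)$ be a valid risk estimator with associated estimator $\widehat H(D_x)$ of $CV$, and define $$\widehat R_D^*(d):=T^*(n,d)\,L_D(f_d(\cdot;\hat\alpha(D))),\qquad T^*(n,d)=\frac{1+(1/n)\operatorname{Tr}(CV)}{1-(d/n)}.$$ If $\widehat H(D_x)$ depends only on the unlabeled data, i.e. $\widehat H(D_x)=\widehat H(D_U)$, then $$E\left[\left(R^*(d)-\widehat R_D(d)\right)^2\right]=E\left[\left(R^*(d)-\widehat R_D^*(d)\right)^2\right]+2\,\frac{\mathrm{bias}(\widehat H)}{n-d}\,\mathrm{cov}\left(\widehat R_D^*(d),\,L_D(f_d(\cdot;\hat\alpha(D)))\right)+\frac{\mathrm{MSE}(\widehat H)}{(n-d)^2}\,E\left[L_D(f_d(\cdot;\hat\alpha(D)))^2\right],$$ where $\mathrm{cov}$ denotes the usual covariance, $\mathrm{bias}(\widehat H):=E[\operatorname{Tr}(\widehat H)-\operatorname{Tr}(CV)]$ and $\mathrm{MSE}(\widehat H):=E\left[(\operatorname{Tr}(\widehat H)-\operatorname{Tr}(CV))^2\right]$, and expectations are over all the data $D$ and $D_U$.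
   Context: Setting. Let $\mathcal X\subset\mathbb R^M$. The training data $D=\{(x_1,y_1),\dots,(x_n,y_n)\}$ are i.i.d. from a joint density $p(x,y)=p(x)p(y|x)$ on $\mathcal X\times\mathbb R$, with $y_i=f_*(x_i)+\xi_i$, where $f_*\in L^2(\mathcal X)$ is an unknown regression function and the noise $\xi_i$ has mean zero and variance $\sigma^2$ and is independent of $x_i$. In addition there are unlabeled data $D_U=\{x'_1,\dots,x'_{n'}\}$, i.i.d. from $p(x)$ and independent of $D$. Put $D_0=\{x_1,\dots,x_n\}$ and $D_x=D_0\cup D_U$. Given real-valued functions $\phi_1,\dots,\phi_d$ on $\mathcal X$, put $f_d(x;\alpha)=\sum_{k=1}^d\alpha_k\phi_k(x)$ for $\alpha\in\mathbb R^d$ and $\mathcal M_d=\{f_d(\cdot;\alpha):\alpha\in\mathbb R^d\}$. The loss of a (fixed) function $f$ is $L(f)=E_{x,y}[(y-f(x))^2]$, where $(x,y)\sim p$ (a fresh draw independent of the data). The empirical loss is $L_D(f)=\frac1n\sum_{i=1}^n(y_i-f(x_i))^2$. $\Phi$ is the $n\times d$ matrix with $(i,k)$ entry $\phi_k(x_i)$, and $\hat\alpha=\hat\alpha(D)=(\Phi^T\Phi)^{-1}\Phi^Ty$, $y=(y_1,\dots,y_n)^T$, is the least squares estimator minimizing $L_D(f_d(\cdot;\alpha))$ over $\alpha\in\mathbb R^d$. The risk is the constant $R^*(d)=E_D[L(f_d(\cdot;\hat\alpha(D)))]$. Let $C$ be the $d\times d$ matrix with entries $C_{kk'}=E_x[\phi_k(x)\phi_{k'}(x)]$,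 $\widehat C=(1/n)\Phi^T\Phi$, and $V=E_D[\widehat C^{-1}]$. Valid risk estimator: $\widehat R_D(d)$ is called valid if there exists a consistent estimator $\widehat H(D_x)$ of $CV$ (i.e. $\widehat H(D_x)$ converges to the true value $CV$ in probability as $n,n'\to\infty$) such that $$\widehat R_D(d)=\widehat T(n,d)\,L_D(f_d(\cdot;\hat\alpha)),\qquad \widehat T(n,d)=\frac{1+(1/n)\operatorname{Tr}(\widehat H(D_x))}{1-(d/n)}.$$ Implicit standing assumptions: $d<n$, $\Phi^T\Phi$ is invertible almost surely, $E_D[L_D(f_d(\cdot;\hat\alpha(D)))]\neq 0$, and all expectations appearing exist and are finite. *)

(* Defs.v *)
From HB Require Import structures.
From mathcomp Require Import all_boot all_order all_algebra.
From mathcomp Require Import all_classical all_reals all_analysis.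
Import Order.TTheory GRing.Theory Num.Theory.
Import numFieldNormedType.Exports.

Set Implicit Arguments.
Unset Strict Implicit.
Unset Printing Implicit Defensive.

Local Open Scope classical_set_scope.
Local Open Scope ring_scope.

Section independence.
Context d d1 d2 (Omega : measurableType d) (T1 : measurableType d1)
  (T2 : measurableType d2) (R : realType) (P : probability Omega R).

Definition independent_pair (U : Omega -> T1) (V : Omega -> T2) : Prop :=
  forall (A : set T1) (B : set T2), measurable A -> measurable B ->
    P (U @^-1` A `&` V @^-1` B) = (P (U @^-1` A) * P (V @^-1` B))%E.

Definition mutually_independent (U : nat -> Omega -> T1) : Prop :=
  forall (s : seq nat) (A : nat -> set T1), uniq s ->
    (forall i, measurable (A i)) ->
    P (\bigcap_(i in [set` s]) (U i @^-1` A i)) =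
      (\prod_(i <- s) P (U i @^-1` A i))%E.

Definition iid (law : probability T1 R) (U : nat -> Omega -> T1) : Prop :=
  mutually_independent U /\
  (forall i A, measurable A -> P (U i @^-1` A) = law A).

End independence.

(* Lebesgue measure on R^n, as the n-fold product of the one on R. *)
Fixpoint lebesgue_tuple (R : realType) (n : nat) : set (n.-tuple R) -> \bar R :=
  match n return set (n.-tuple R) -> \bar R with
  | 0%N => dirac [tuple]
  | m.+1 => pushforward (lebesgue_tuple (R := R) (n := m) \x lebesgue_measure)%E
              (fun z : m.-tuple R * R => [tuple of z.2 :: z.1])
  end.

Definition has_density (R : realType) (M : nat)
    (law : probability (M.-tuple R * R)%type R) (p : M.-tuple R * R -> R) :=
  [/\ measurable_fun setT p, forall z, 0 <= p z &
    forall A, measurable A ->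
      law A = (\int[@lebesgue_tuple R M \x lebesgue_measure]_(z in A) (p z)%:E)%E].

(* Entries of a matrix, read in R^{m x n} with its product sigma-algebra. *)
Definition mx_tuple (R : realType) m n (A : 'M[R]_(m, n)) :
    m.-tuple (n.-tuple R) :=
  [tuple [tuple A i j | j < n] | i < m].

Definition is_argmin (T : Type) (R : realType) (S : set T) (J : T -> \bar R)
    (f : T) : Prop :=
  S f /\ forall g, S g -> (J f <= J g)%E.

Section least_squares.
Context (R : realType) (M d : nat).
Local Notation feature := (M.-tuple R).
(* Only the values of phi on the input domain are used. *)
Variable phi : 'I_d -> feature -> R.

Definition linear_fun (alpha : 'cV[R]_d) (x : feature) : R :=
  \sum_(k < d) alpha k ord0 * phi k x.

Definition model_class : set (feature -> R) := range linear_fun.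

Definition inputs n (D : n.-tuple (feature * R)%type) : n.-tuple feature :=
  [tuple (tnth D i).1 | i < n].

Definition outputs n (D : n.-tuple (feature * R)%type) : 'cV[R]_n :=
  \col_i (tnth D i).2.

Definition design n (D0 : n.-tuple feature) : 'M[R]_(n, d) :=
  \matrix_(i, k) phi k (tnth D0 i).

Definition empirical_loss n (D : n.-tuple (feature * R)%type)
    (f : feature -> R) : R :=
  n%:R^-1 * \sum_(i < n) ((tnth D i).2 - f (tnth D i).1) ^+ 2.

Definition gram n (D0 : n.-tuple feature) : 'M[R]_d :=
  (design D0)^T *m design D0.

Definition Chat n (D0 : n.-tuple feature) : 'M[R]_d :=
  n%:R^-1 *: gram D0.

Definition ols n (D : n.-tuple (feature * R)%type) : 'cV[R]_d :=
  invmx (gram (inputs D)) *m (design (inputs D))^T *m outputs D.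

Definition fitted_loss n (D : n.-tuple (feature * R)%type) : R :=
  empirical_loss D (linear_fun (ols D)).

(* The common form of T^ (H an estimate of CV) and T^* (H = CV). *)
Definition inflation n (H : 'M[R]_d) : R :=
  (1 + n%:R^-1 * \tr H) / (1 - d%:R / n%:R).

Section population.
Variables (X : set feature) (law : probability (feature * R)%type R).

(* Integrals are restricted to the domain X x R, which has full mass. *)
Definition loss (f : feature -> R) : \bar R :=
  (\int[law]_(z in X `*` setT) ((z.2 - f z.1) ^+ 2)%:E)%E.

Definition Cmx : 'M[R]_d :=
  \matrix_(k, l)
    fine (\int[law]_(z in X `*` setT) (phi k z.1 * phi l z.1)%:E)%E.

End population.

End least_squares.

Section sampling.
Context dO (Omega : measurableType dO) (R : realType) (P : probability Omega R).
Context (M d : nat) (phi : 'I_d -> M.-tuple R -> R) (X : set (M.-tuple R)).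
Local Notation feature := (M.-tuple R).
Variables (law : probability (feature * R)%type R).
(* Labelled inputs, labels and unlabelled inputs: the data sets of all sizes
   are initial segments of one infinite sample. *)
Variables (x : nat -> Omega -> feature) (y : nat -> Omega -> R)
  (x' : nat -> Omega -> feature).

Definition labeled_data n (w : Omega) : n.-tuple (feature * R)%type :=
  [tuple (x i w, y i w) | i < n].

Definition labeled_inputs n (w : Omega) : n.-tuple feature :=
  [tuple x i w | i < n].

Definition unlabeled_data n' (w : Omega) : n'.-tuple feature :=
  [tuple x' j w | j < n'].

Definition Vmx n : 'M[R]_d :=
  \matrix_(k, l)
    fine 'E_P[fun w => invmx (Chat phi (labeled_inputs n w)) k l]%E.

(* R^*(d), as an extended real. *)
Definition risk n : \bar R :=
  (\int[P]_w loss X law (linear_fun phi (ols phi (labeled_data n w))))%E.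

Definition CVmx n : 'M[R]_d := Cmx phi X law *m Vmx n.

Definition residuals (f : feature -> R) n (w : Omega) : n.-tuple R :=
  [tuple y i w - f (x i w) | i < n].

Definition matrix_estimator :=
  forall n n', n.-tuple feature -> n'.-tuple feature -> 'M[R]_d.

Definition risk_estimator :=
  forall n n', n.-tuple (feature * R)%type -> n'.-tuple feature -> R.

Definition in_domain n (t : n.-tuple feature) : Prop :=
  forall i, X (tnth t i).

Definition measurable_estimator (H : matrix_estimator) : Prop :=
  forall n n' k l,
    measurable_fun [set D : n.-tuple feature * n'.-tuple feature |
                     in_domain D.1 /\ in_domain D.2]
      (fun D => H n n' D.1 D.2 k l).

(* Convergence in probability of every entry as n and n' jointly tend to
   infinity; the target CV itself depends on n through V. *)
Definition consistent (H : matrix_estimator) : Prop :=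
  forall (k l : 'I_d) (eps : R), 0 < eps ->
    P [set w | eps <= `| H nn.1 nn.2 (labeled_inputs nn.1 w)
                           (unlabeled_data nn.2 w) k l - CVmx nn.1 k l |]
      @[nn --> (\oo, \oo)] --> 0%E.

(* [Rhat] is a valid risk estimator, with associated estimator [H] of CV. *)
Definition valid_risk_estimator (Rhat : risk_estimator) (H : matrix_estimator)
    : Prop :=
  [/\ measurable_estimator H, consistent H &
    forall n n' (D : n.-tuple (feature * R)%type) (DU : n'.-tuple feature),
      (d < n)%N -> in_domain (inputs D) -> in_domain DU ->
      Rhat n n' D DU = inflation n (H n n' (inputs D) DU) * fitted_loss phi D].

Definition unlabeled_only (H : matrix_estimator) : Prop :=
  exists HU : forall n n', n'.-tuple feature -> 'M[R]_d,
    forall n n' (D0 : n.-tuple feature) (DU : n'.-tuple feature),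
      in_domain D0 -> in_domain DU -> H n n' D0 DU = HU n n' DU.

(* The input/output model: i.i.d. pairs with a joint density on X x R, a
   regression function in L^2(X, p(x) dx), centred noise of variance sigma2
   independent of the input, and an independent i.i.d. sample from the
   marginal law of the input. *)
Record regression_model (p : feature * R -> R) (fstar : feature -> R)
    (xi : nat -> Omega -> R) (sigma2 : R) : Prop := RegressionModel {
  domain_measurable : measurable X ;
  density_law : has_density law p ;
  density_support : forall z, ~ X z.1 -> p z = 0 ;
  fstar_measurable : measurable_fun X fstar ;
  fstar_L2 : law.-integrable (X `*` setT) (fun z => (fstar z.1 ^+ 2)%:E) ;
  x_measurable : forall i, measurable_fun setT (x i) ;
  xi_measurable : forall i, measurable_fun setT (xi i) ;
  x'_measurable : forall j, measurable_fun setT (x' j) ;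
  x_domain : forall i w, X (x i w) ;
  x'_domain : forall j w, X (x' j w) ;
  outputE : forall i w, y i w = fstar (x i w) + xi i w ;
  noise_mean : forall i, ('E_P[xi i] = 0)%E ;
  noise_variance : forall i, ('V_P[xi i] = sigma2%:E)%E ;
  noise_indep : forall i, independent_pair P (x i) (xi i) ;
  labeled_iid : iid P law (fun i w => (x i w, y i w)) ;
  unlabeled_indep : mutually_independent P x' ;
  unlabeled_law : forall j A, measurable A ->
    P (x' j @^-1` A) = law (A `*` setT) ;
  labeled_unlabeled_indep : forall n n',
    independent_pair P (labeled_data n) (unlabeled_data n')
}.

(* Standing assumptions for the sample sizes n and n': the least squares
   estimator is defined almost surely and the expectations in play are finite. *)
Record standing_assumptions (H : matrix_estimator) (n n' : nat) : Prop :=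
    StandingAssumptions {
  dim_lt_size : (d < n)%N ;
  phi_measurable : forall k, measurable_fun X (phi k) ;
  gram_unit :
    {ae P, forall w, gram phi (labeled_inputs n w) \in unitmx} ;
  C_finite : forall k l, law.-integrable (X `*` setT)
    (fun z => (phi k z.1 * phi l z.1)%:E) ;
  V_finite : forall k l,
    (fun w => invmx (Chat phi (labeled_inputs n w)) k l) \in Lfun P 1%E ;
  risk_finite : risk n \is a fin_num ;
  fitted_loss_L2 :
    (fun w => fitted_loss phi (labeled_data n w)) \in Lfun P 2%:E ;
  fitted_loss_neq0 :
    ('E_P[fun w => fitted_loss phi (labeled_data n w)] != 0)%E ;
  trace_L2 :
    (fun w => \tr (H n n' (labeled_inputs n w) (unlabeled_data n' w)))
      \in Lfun P 2%:E
}.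

Definition trace_error (H : matrix_estimator) n n' (w : Omega) : R :=
  \tr (H n n' (labeled_inputs n w) (unlabeled_data n' w)) - \tr (CVmx n).

Definition bias (H : matrix_estimator) n n' : \bar R :=
  'E_P[trace_error H n n']%E.

Definition MSE (H : matrix_estimator) n n' : \bar R :=
  'E_P[fun w => (trace_error H n n' w ^+ 2)%R]%E.

End sampling.

(* Main.v *)
(* Write r for the vector of residuals y_i - f*(x_i), f* = f_d^* being the best
   approximation in the model, and F for the design matrix. Optimality of f*
   makes the residuals orthogonal to every phi_k; as phi_1 = 1 they are centred,
   hence uncorrelated with common variance s2 = L(f* ). Almost surely
   n L_D(f_d(.; alpha^)) = |(1 - F (F^T F)^-1 F^T) r|^2 and
   L(f_d(.; alpha^)) = s2 + r^T Q r with Q = F (F^T F)^-1 C (F^T F)^-1 F^T.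
   Since r and F are independent, a positive semidefinite quadratic form Q(F)
   satisfies E[r^T Q(F) r] = s2 E[tr Q(F)], whence
   E[L_D] = s2 (n - d) / n and R^* = s2 (1 + tr(CV) / n) = T^* E[L_D]: the
   estimator T^* L_D is unbiased. Finally T^ - T^* = (tr H^ - tr(CV)) / (n - d)
   is a function of D_U, hence independent of L_D; expanding the square gives
   the three terms, the middle one being a covariance by unbiasedness. *)
Require Import Defs.
From mathcomp Require Import all_boot all_order all_algebra.
From mathcomp Require Import all_classical all_reals all_analysis.
From mathcomp Require Import measurable_realfun ring lra.
Import Order.TTheory GRing.Theory Num.Theory.
Import numFieldNormedType.Exports.

Set Implicit Arguments.
Unset Strict Implicit.
Unset Printing Implicit Defensive.

Local Open Scope classical_set_scope.
Local Open Scope ring_scope.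

(** * Random matrices *)

Section measurable_matrix.
Context d (T : measurableType d) (R : realType).

(** Inversion is continuous on the open set of nonzero reals, and the remaining point is a
    measurable singleton. *)
Lemma measurable_invr : measurable_fun [set: R] (@GRing.inv R).
Proof.
rewrite -(setvU [set 0]) setUC; apply/measurable_funU => //.
  exact/measurableC.
split; first exact: measurable_fun_set1.
apply: open_continuous_measurable_fun.
  exact/closed_openC/accessible_closed_set1/hausdorff_accessible/Rhausdorff.
by move=> x; rewrite inE => /eqP x0; exact: inv_continuous.
Qed.

Definition mx_measurable m n (A : T -> 'M[R]_(m, n)) : Prop :=
  forall i j, measurable_fun setT (fun t => A t i j).

Lemma mx_measurable_cst m n (A : 'M[R]_(m, n)) : mx_measurable (fun=> A).
Proof. by move=> i j; exact: measurable_cst. Qed.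

Lemma mx_measurableM m n p (A : T -> 'M[R]_(m, n)) (B : T -> 'M[R]_(n, p)) :
  mx_measurable A -> mx_measurable B -> mx_measurable (fun t => A t *m B t).
Proof.
move=> mA mB i j; under eq_fun do rewrite mxE.
by apply: measurable_sum => k; exact: measurable_funM.
Qed.

Lemma mx_measurableB m n (A B : T -> 'M[R]_(m, n)) :
  mx_measurable A -> mx_measurable B -> mx_measurable (fun t => A t - B t).
Proof.
move=> mA mB i j; under eq_fun do rewrite !mxE.
exact: measurable_funB.
Qed.

Lemma mx_measurableT m n (A : T -> 'M[R]_(m, n)) :
  mx_measurable A -> mx_measurable (fun t => (A t)^T).
Proof. by move=> mA i j; under eq_fun do rewrite mxE; exact: mA. Qed.

Lemma mx_measurable_trace n (A : T -> 'M[R]_n) :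
  mx_measurable A -> measurable_fun setT (fun t => \tr (A t)).
Proof. by move=> mA; apply: measurable_sum => i; exact: mA. Qed.

Lemma mx_measurable_det n (A : T -> 'M[R]_n) :
  mx_measurable A -> measurable_fun setT (fun t => \det (A t)).
Proof.
move=> mA; apply: measurable_sum => s; apply: measurable_funM => //.
by apply: measurable_prod => i _; exact: mA.
Qed.

(** Cramer's rule expresses the entries as cofactors over the determinant. The case split is needed
    because [invmx] returns its argument on singular matrices. *)
Lemma mx_measurable_inv n (A : T -> 'M[R]_n) :
  mx_measurable A -> mx_measurable (fun t => invmx (A t)).
Proof.
move=> mA i j; have mdet := mx_measurable_det mA.
rewrite (_ : (fun t => _) = fun t =>
    if \det (A t) == 0 then A t i j else (\det (A t))^-1 * (\adj (A t)) i j).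
  apply: measurable_fun_ifT; [exact: measurable_fun_eqr|exact: mA|].
  apply: measurable_funM; first exact: (measurableT_comp measurable_invr).
  under eq_fun do rewrite mxE.
  apply: measurable_funM => //; apply: mx_measurable_det => k l.
  by under eq_fun do rewrite !mxE; exact: mA.
apply/funext => t; rewrite /invmx unitmxE unitfE.
by case: eqP => //= _; rewrite mxE.
Qed.

End measurable_matrix.

(** * Independence *)

Section independence.
Context d d1 d2 (Omega : measurableType d) (T1 : measurableType d1)
  (T2 : measurableType d2) (R : realType) (P : probability Omega R).
Variables (U : Omega -> T1) (V : Omega -> T2).
Hypotheses (mU : measurable_fun setT U) (mV : measurable_fun setT V).
Hypothesis UV : independent_pair P U V.

Let U' : {mfun Omega >-> T1} := mfun_Sub (mem_set mU).
Let V' : {mfun Omega >-> T2} := mfun_Sub (mem_set mV).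
Let lawU : probability T1 R := distribution P U'.
Let lawV : probability T2 R := distribution P V'.
Let mUV : measurable_fun setT (fun w => (U w, V w)).
Proof. exact: measurable_fun_pair. Qed.
Let UV' : {mfun Omega >-> (T1 * T2)%type} := mfun_Sub (mem_set mUV).

(** Independence is the product formula on measurable rectangles, and these determine the product
    measure. *)
Lemma independent_joint_law (A : set (T1 * T2)) : measurable A ->
  (lawU \x lawV)%E A = distribution P UV' A.
Proof.
apply: product_measure_unique => B C mB mC.
by rewrite -[RHS]UV.
Qed.

(** Tonelli for the joint law. Both integrals are pulled back to [Omega], with an independent copy
    [w'] of the sample point, so that later uses never mention the laws of [U] and [V]. *)
Lemma independent_integral (f : T1 * T2 -> \bar R) :
  measurable_fun setT f -> (forall z, 0 <= f z)%E ->
  (\int[P]_w f (U w, V w) = \int[P]_w' \int[P]_w f (U w, V w'))%E.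
Proof.
move=> mf f0.
transitivity (\int[distribution P UV']_z f z)%E.
  by rewrite ge0_integral_distribution.
rewrite (eq_measure_integral (lawU \x lawV)%E); last first.
  by move=> A mA _; apply/esym; exact: independent_joint_law.
rewrite fubini_tonelli2// /lawV ge0_integral_distribution//; last 2 first.
- exact: measurable_fun_fubini_tonelli_G.
- by move=> y; exact: integral_ge0.
apply: eq_integral => w _ /=; rewrite /fubini_G /lawU.
rewrite ge0_integral_distribution//.
exact: (measurable_fun_pair1 _ mf).
Qed.

(** Tonelli on absolute values gives integrability of the product, after which Fubini gives its
    expectation. *)
Lemma independent_mul (f : T1 -> R) (g : T2 -> R) :
  measurable_fun setT f -> measurable_fun setT g ->
  f \o U \in Lfun P 1 -> g \o V \in Lfun P 1 ->
  ((f \o U) \* (g \o V)) \in Lfun P 1 /\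
  ('E_P[(f \o U) \* (g \o V)] = 'E_P[f \o U] * 'E_P[g \o V])%E.
Proof.
move=> mf mg fU gV.
have mfg : measurable_fun setT (fun z : T1 * T2 => f z.1 * g z.2).
  by apply: measurable_funM; exact: measurableT_comp.
have /Lfun1_integrable/integrableP[mfU fUoo] := fU.
have /Lfun1_integrable/integrableP[mgV gVoo] := gV.
have ifg : P.-integrable setT (EFin \o ((f \o U) \* (g \o V))).
  apply/integrableP; split.
    by apply/measurable_EFinP/measurable_funM; exact: measurableT_comp.
  (* The integral of the absolute value becomes E|f(U)| E|g(V)|, a product of two finite numbers. *)
  rewrite [ltLHS](_ : _ = \int[P]_w (`|f (U w) * g (V w)|)%:E)%E//.
  rewrite (@independent_integral (fun z => (`|f z.1 * g z.2|)%:E))//=;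
    last first.
    by apply/measurable_EFinP; exact: measurableT_comp.
  under eq_integral => w' _.
    under eq_integral => w _ do rewrite normrM EFinM.
    rewrite ge0_integralZr//; last first.
      by apply/measurable_EFinP; do 2 apply: measurableT_comp => //.
    over.
  rewrite /= ge0_integralZl//.
  - apply: lte_mul_pinfty => //; first exact: integral_ge0.
    by rewrite ge0_fin_numE//; exact: integral_ge0.
  - by apply/measurable_EFinP; do 2 apply: measurableT_comp => //.
  - exact: integral_ge0.
split; first exact/Lfun1_integrable.
rewrite unlock.
transitivity (\int[distribution P UV']_z (f z.1 * g z.2)%:E)%E.
  by rewrite integral_distribution//; exact/measurable_EFinP.
rewrite (eq_measure_integral (lawU \x lawV)%E); last first.
  by move=> A mA _; apply/esym; exact: independent_joint_law.
(* Fubini asks for integrability under the product of the laws; it is carried over from the joint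
   law, which is the same measure. *)
rewrite -integral21_prod_meas1; last first.
  have : (distribution P UV').-integrable setT
      (fun z : T1 * T2 => (f z.1 * g z.2)%:E).
    by apply: integrable_pushforward => //; exact/measurable_EFinP.
  move=> /integrableP[mF Foo]; apply/integrableP; split => //.
  rewrite (eq_measure_integral (distribution P UV'))//.
  by move=> A mA _; exact: independent_joint_law.
have iU : lawU.-integrable setT (EFin \o f).
  apply: integrable_pushforward => //; first exact/measurable_EFinP.
  exact/Lfun1_integrable.
have iV : lawV.-integrable setT (EFin \o g).
  apply: integrable_pushforward => //; first exact/measurable_EFinP.
  exact/Lfun1_integrable.
rewrite /fubini_G.
under eq_integral => v _.
  under eq_integral => u _ do rewrite /= EFinM.
  rewrite integralZr//.
  over.
have fin : (\int[lawU]_x (f x)%:E)%E \is a fin_num.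
  exact: integrable_fin_num.
rewrite -(fineK fin) /= integralZl// fineK//.
rewrite /lawU /lawV !integral_distribution//.
- exact/measurable_EFinP.
- exact/Lfun1_integrable.
- exact/measurable_EFinP.
- exact/Lfun1_integrable.
Qed.

End independence.

(** * Expectations and quadratic forms *)

Section square_integrable.
Context d (Omega : measurableType d) (R : realType) (P : probability Omega R).
Implicit Types f g : Omega -> R.

Lemma Lfun_measurable p f : f \in Lfun P p -> measurable_fun setT f.
Proof. by rewrite inE => /andP[/[!inE]]. Qed.

Lemma Lfun2P f : measurable_fun setT f ->
  ('E_P[fun w => (f w ^+ 2)%R] < +oo)%E -> f \in Lfun P 2%:E.
Proof.
move=> mf foo; rewrite inE; apply/andP; split; rewrite inE//=.
rewrite /finite_norm unlock /Lnorm poweR_lty//=.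
rewrite expectation.unlock in foo; apply: le_lt_trans foo.
by under eq_integral => w _ do
  rewrite powR_mulrn// -normrX ger0_norm ?sqr_ge0//.
Qed.

Lemma Lfun1M f g : f \in Lfun P 2%:E -> g \in Lfun P 2%:E ->
  (fun w => f w * g w) \in Lfun P 1.
Proof. exact: Lfun2_mul_Lfun1. Qed.

Lemma Lfun21 f : f \in Lfun P 2%:E -> f \in Lfun P 1.
Proof. by apply: Lfun_subset12; rewrite fin_num_measure. Qed.

Lemma Lfun1_sum (I : Type) (s : seq I) (c : I -> R) (f : I -> Omega -> R) :
  (forall i, f i \in Lfun P 1) ->
  (fun w => \sum_(i <- s) c i * f i w) \in Lfun P 1.
Proof.
move=> fL; rewrite (_ : (fun w => _) = \sum_(i <- s) c i *: f i).
  by apply: rpred_sum => i _; apply: rpredZ.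
by apply/funext => w; rewrite fct_sumE.
Qed.

Lemma expectation_lin (I : Type) (s : seq I) (c : I -> R)
    (f : I -> Omega -> R) :
  (forall i, f i \in Lfun P 1) ->
  'E_P[fun w => (\sum_(i <- s) c i * f i w)%R]%E =
  (\sum_(i <- s) c i * fine 'E_P[f i]%E)%:E.
Proof.
move=> fL; elim: s => [|i s IH].
  rewrite big_nil (_ : (fun w => _) = cst 0) ?expectation_cst//.
  by apply/funext => w; rewrite big_nil.
rewrite big_cons (_ : (fun w => _) =
    (c i \o* f i) \+ (fun w => \sum_(i <- s) c i * f i w)); last first.
  by apply/funext => w; rewrite big_cons /= mulrC.
rewrite expectationD ?IH; last 2 first.
- exact: Lfun_scale.
- exact: Lfun1_sum.
rewrite expectationZl// EFinD EFinM fineK//.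
exact: expectation_fin_num.
Qed.

End square_integrable.

(** * Quadratic forms and their expectations *)

Definition quad (R : comRingType) n (A : 'M[R]_n) (u : 'cV[R]_n) : R :=
  (u^T *m A *m u) ord0 ord0.

Lemma quadE (R : comRingType) n (A : 'M[R]_n) (u : 'cV[R]_n) :
  quad A u = \sum_i \sum_j A i j * (u i ord0 * u j ord0).
Proof.
rewrite /quad mxE exchange_big /=; apply: eq_bigr => j _.
rewrite mxE big_distrl /=; apply: eq_bigr => i _.
by rewrite mxE mulrAC mulrC mulrA.
Qed.

Lemma quad_conj (R : comRingType) m n (A : 'M[R]_n) (B : 'M[R]_(n, m))
    (u : 'cV[R]_m) :
  quad A (B *m u) = quad (B^T *m A *m B) u.
Proof. by rewrite /quad trmx_mul !mulmxA. Qed.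

Lemma quad1 (R : comRingType) n (u : 'cV[R]_n) :
  quad 1%:M u = \sum_i u i ord0 ^+ 2.
Proof.
by rewrite /quad mulmx1 mxE; apply: eq_bigr => i _; rewrite mxE expr2.
Qed.

Lemma measurable_quad d (T : measurableType d) (R : realType) n
    (A : T -> 'M[R]_n) (u : T -> 'cV[R]_n) :
  mx_measurable A -> mx_measurable u ->
  measurable_fun setT (fun t => quad (A t) (u t)).
Proof.
move=> mA mu.
have := mx_measurableM (mx_measurableM (mx_measurableT mu) mA) mu.
exact.
Qed.

Section quadratic_expectation.
Context d d2 (Omega : measurableType d) (T2 : measurableType d2)
  (R : realType) (P : probability Omega R).

(* Nonnegativity of the form allows Tonelli's theorem, so that no integrability
   of the entries of [Q (V w)] is needed. *)
Lemma expectation_quad n (r : Omega -> n.-tuple R) (V : Omega -> T2)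
    (Q : T2 -> 'M[R]_n) (s2 : R) :
  measurable_fun setT r -> measurable_fun setT V -> mx_measurable Q ->
  independent_pair P r V ->
  (forall t u, 0 <= quad (Q t) u) ->
  (forall i, (fun w => tnth (r w) i) \in Lfun P 2%:E) ->
  (forall i j, 'E_P[fun w => (tnth (r w) i * tnth (r w) j)%R]%E =
     (s2 *+ (i == j))%:E) ->
  'E_P[fun w => (quad (Q (V w)) (\col_i tnth (r w) i))%R]%E =
  'E_P[fun w => (s2 * \tr (Q (V w)))%R]%E.
Proof.
move=> mr mV mQ rV Q0 rL2 rE; rewrite expectation.unlock.
pose h (z : n.-tuple R * T2) := (quad (Q z.2) (\col_i tnth z.1 i))%:E.
rewrite (independent_integral mr mV rV (f := h)); last 2 first.
- apply/measurable_EFinP; apply: measurable_quad => i j.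
    exact: (measurableT_comp (mQ i j)).
  under eq_fun do rewrite mxE.
  exact: (measurableT_comp (measurable_tnth i)).
- by move=> z; rewrite lee_fin.
apply: eq_integral => w _; rewrite /h /=.
(* With the matrix frozen at [V w], the form is a finite combination, over pairs of indices, of
   products of coordinates of [r]. The second moments of [r] then leave only the diagonal, that is,
   the trace. *)
rewrite (_ : (\int[P]_w' _)%E = 'E_P[fun w' =>
   (\sum_p Q (V w) p.1 p.2 * (tnth (r w') p.1 * tnth (r w') p.2))%R]%E);
  last first.
  rewrite expectation.unlock; apply: eq_integral => w' _; congr EFin.
  rewrite quadE pair_bigA /=; apply: eq_bigr => p _.
  by rewrite !mxE.
rewrite expectation_lin; last by move=> p; exact: Lfun1M.
congr EFin; rewrite -(pair_bigA _ (fun i j => Q (V w) i j *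
  fine 'E_P[fun w => (tnth (r w) i * tnth (r w) j)%R]%E)) /=.
rewrite /mxtrace mulr_sumr; apply: eq_bigr => i _.
rewrite (bigD1 i)//= rE eqxx big1 ?addr0 1?mulrC// => j ji.
by rewrite rE eq_sym (negbTE ji) mulr0.
Qed.

End quadratic_expectation.

(** * Integrals against a law as expectations of a random point with that law *)

Section transfer.
Context d d' (Omega : measurableType d) (T : measurableType d') (R : realType)
  (P : probability Omega R) (law : probability T R).
Variables (z : Omega -> T) (D : set T).
Hypotheses (mz : measurable_fun setT z) (mD : measurable D).
Hypotheses (Dz : forall w, D (z w))
  (lawz : forall A, measurable A -> P (z @^-1` A) = law A).

Lemma measurable_comp_law d1 (T1 : measurableType d1) (h : T -> T1) :
  measurable_fun D h -> measurable_fun setT (h \o z).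
Proof. by move=> mh; apply: (measurable_comp mD) => //; move=> _ [w _ <-]. Qed.

Lemma ge0_integral_law (h : T -> \bar R) : measurable_fun D h ->
  (forall t, 0 <= h t)%E -> (\int[law]_(t in D) h t = \int[P]_w h (z w))%E.
Proof.
move=> mh h0; rewrite (eq_measure_integral (pushforward P z)); last first.
  by move=> A mA _ /=; rewrite -lawz.
rewrite ge0_integral_pushforward//.
(* Every value of [z] lies in [D], so the restriction of the integral to [D] disappears on
   [Omega]. *)
have zD : z @^-1` D = setT by apply/seteqP; split => w _ /=.
by rewrite zD.
Qed.

Lemma integral_law (h : T -> \bar R) : measurable_fun D h ->
  (\int[law]_(t in D) h t = \int[P]_w h (z w))%E.
Proof.
move=> mh; rewrite integralE [RHS]integralE; congr (_ - _)%E.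
- rewrite ge0_integral_law; [|exact: measurable_funepos|by []].
  by apply: eq_integral => w _; rewrite !funeposE.
- rewrite ge0_integral_law; [|exact: measurable_funeneg|by []].
  by apply: eq_integral => w _; rewrite !funenegE.
Qed.

Lemma Lfun1_law (h : T -> R) : law.-integrable D (EFin \o h) ->
  (fun w => h (z w)) \in Lfun P 1.
Proof.
move=> /integrableP[mh hoo]; apply/Lfun1_integrable/integrableP; split.
  exact: (measurable_comp_law mh).
apply: le_lt_trans hoo; rewrite ge0_integral_law//.
exact: measurableT_comp.
Qed.

End transfer.

(** * Least squares algebra *)

Section hat_matrix.
Context (R : realType) (n d : nat).
Implicit Type F : 'M[R]_(n, d).

(** For an invertible Gram matrix this is the Moore-Penrose pseudoinverse of [F]. *)
Definition ols_mx F : 'M[R]_(d, n) := invmx (F^T *m F) *m F^T.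

(** For an invertible Gram matrix this is the orthogonal projection onto the complement of the
    column space of [F]. *)
Definition resid_mx F : 'M[R]_n := 1%:M - F *m ols_mx F.

(* Equal to [resid_mx F] when [F^T *m F] is invertible; this form is positive
   semidefinite also when it is not ([invmx] is then the identity map). *)
Definition rss_mx F : 'M[R]_n := (resid_mx F)^T *m resid_mx F.

Lemma invmx_gramT F : (invmx (F^T *m F))^T = invmx (F^T *m F).
Proof. by rewrite trmx_inv trmx_mul trmxK. Qed.

Lemma ols_mxK F : F^T *m F \in unitmx -> ols_mx F *m F = 1%:M.
Proof. by move=> uF; rewrite /ols_mx -mulmxA mulVmx. Qed.

Lemma resid_mx_design F : F^T *m F \in unitmx -> resid_mx F *m F = 0.
Proof.
by move=> uF; rewrite /resid_mx mulmxBl mul1mx -mulmxA ols_mxK// mulmx1 subrr.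
Qed.

(** The residual matrix is symmetric and kills [F], hence is idempotent and equals [rss_mx F]. By
    cyclicity the trace of the hat matrix [F *m ols_mx F] is that of the identity of size d. *)
Lemma trace_rss_mx F : F^T *m F \in unitmx -> \tr (rss_mx F) = n%:R - d%:R.
Proof.
move=> uF.
have symR : (resid_mx F)^T = resid_mx F.
  rewrite /resid_mx linearB /= trmx1; congr (_ - _).
  by rewrite /ols_mx !trmx_mul trmxK invmx_gramT mulmxA.
rewrite /rss_mx symR {2}/resid_mx mulmxBr mulmx1 mulmxA resid_mx_design//.
rewrite mul0mx subr0 /resid_mx linearB /= mxtrace1 mxtrace_mulC ols_mxK//.
by rewrite mxtrace1.
Qed.

Lemma quad_rss_mx F (u : 'cV[R]_n) :
  quad (rss_mx F) u = \sum_i (resid_mx F *m u) i ord0 ^+ 2.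
Proof. by rewrite -quad1 quad_conj mulmx1. Qed.

(** Cyclicity brings [ols_mx F] next to its transpose, and their product collapses to the inverse
    Gram matrix. This is how V enters the risk. *)
Lemma trace_ols_mx F (C : 'M[R]_d) : F^T *m F \in unitmx ->
  \tr ((ols_mx F)^T *m C *m ols_mx F) = \tr (C *m invmx (F^T *m F)).
Proof.
move=> uF; rewrite -mulmxA mxtrace_mulC -mulmxA; congr (\tr (C *m _)).
rewrite /ols_mx trmx_mul trmxK invmx_gramT mulmxA -(mulmxA (invmx _)).
by rewrite mulVmx// mul1mx.
Qed.

End hat_matrix.

Section fitted.
Context (R : realType) (M d : nat) (phi : 'I_d -> M.-tuple R -> R).
Variables (n : nat) (D : n.-tuple (M.-tuple R * R)).
Let F := design phi (inputs D).

Lemma olsE : ols phi D = ols_mx F *m outputs D.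
Proof. by []. Qed.

Lemma linear_fun_design (b : 'cV[R]_d) i :
  linear_fun phi b (tnth D i).1 = (F *m b) i ord0.
Proof.
by rewrite mxE; apply: eq_bigr => k _; rewrite mxE tnth_mktuple mulrC.
Qed.

(** The vector of fitted residuals is [resid_mx F *m outputs D] by definition of [ols], whether or
    not the Gram matrix is invertible. *)
Lemma fitted_lossE : fitted_loss phi D = n%:R^-1 * quad (rss_mx F) (outputs D).
Proof.
rewrite /fitted_loss /empirical_loss quad_rss_mx; congr (_ * _).
apply: eq_bigr => i _; congr (_ ^+ 2).
by rewrite linear_fun_design olsE mulmxA /resid_mx mulmxBl mul1mx !mxE.
Qed.

End fitted.

(** Decodes [mx_tuple]. Independence from the design matrix is stated for its coded form, so a
    function of the matrix has to be read as a function on tuples. *)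
Definition tuple_mx (R : realType) m n (t : m.-tuple (n.-tuple R)) :
    'M[R]_(m, n) :=
  \matrix_(i, j) tnth (tnth t i) j.

Lemma mx_tupleK (R : realType) m n : cancel (@mx_tuple R m n) (@tuple_mx R m n).
Proof. by move=> A; apply/matrixP => i j; rewrite mxE !tnth_mktuple. Qed.

Lemma measurable_tuple_mx (R : realType) m n :
  mx_measurable (@tuple_mx R m n).
Proof.
move=> i j; under eq_fun do rewrite mxE.
exact: (measurableT_comp (measurable_tnth j) (measurable_tnth i)).
Qed.

Lemma measurable_mx_tuple d (T : measurableType d) (R : realType) m n
    (A : T -> 'M[R]_(m, n)) :
  mx_measurable A -> measurable_fun setT (fun t => mx_tuple (A t)).
Proof.
move=> mA; apply/measurable_fun_tnthP => i /=.
apply/measurable_fun_tnthP => j /=.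
rewrite (_ : _ \o _ = fun t => A t i j); first exact: mA.
by apply/funext => t /=; rewrite !tnth_mktuple.
Qed.

Section measurable_hat.
Context d (T : measurableType d) (R : realType) (n p : nat).
Variable F : T -> 'M[R]_(n, p).
Hypothesis mF : mx_measurable F.

Lemma measurable_ols_mx : mx_measurable (fun t => ols_mx (F t)).
Proof.
apply: mx_measurableM; last exact: mx_measurableT.
by apply: mx_measurable_inv; apply: mx_measurableM => //; exact: mx_measurableT.
Qed.

Lemma measurable_rss_mx : mx_measurable (fun t => rss_mx (F t)).
Proof.
have mR : mx_measurable (fun t => resid_mx (F t)).
  apply: mx_measurableB; first exact: mx_measurable_cst.
  exact: (mx_measurableM mF measurable_ols_mx).
by apply: mx_measurableM => //; exact: mx_measurableT.
Qed.

End measurable_hat.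

(** * The best linear approximation and its residuals *)

Section population.
Context dO (Omega : measurableType dO) (R : realType) (P : probability Omega R)
  (M d : nat) (X : set (M.-tuple R)) (phi : 'I_d -> M.-tuple R -> R)
  (law : probability (M.-tuple R * R)%type R) (p : M.-tuple R * R -> R)
  (fstar : M.-tuple R -> R) (sigma2 : R) (x : nat -> Omega -> M.-tuple R)
  (xi y : nat -> Omega -> R) (x' : nat -> Omega -> M.-tuple R).
Hypothesis model : regression_model P X law x y x' p fstar xi sigma2.
Hypothesis mphi : forall k, measurable_fun X (phi k).
Hypothesis Cfin : forall k l, law.-integrable (X `*` setT)
  (fun z => (phi k z.1 * phi l z.1)%:E).

Let mX : measurable X := domain_measurable model.

Lemma measurable_input i (h : M.-tuple R -> R) : measurable_fun X h ->
  measurable_fun setT (fun w => h (x i w)).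
Proof.
move=> mh; apply: (measurable_comp mX _ mh (x_measurable model i)).
by move=> _ [w _ <-]; exact: (x_domain model).
Qed.

Lemma measurable_output i : measurable_fun setT (y i).
Proof.
rewrite (_ : y i = fun w => fstar (x i w) + xi i w); last first.
  by apply/funext => w; exact: (outputE model).
apply: measurable_funD; last exact: (xi_measurable model).
exact: (measurable_input _ (fstar_measurable model)).
Qed.

Lemma measurable_pair i : measurable_fun setT (fun w => (x i w, y i w)).
Proof.
apply: measurable_fun_pair; first exact: (x_measurable model).
exact: measurable_output.
Qed.

Lemma measurable_domainX : measurable (X `*` [set: R]).
Proof. exact: measurableX. Qed.

Lemma pair_domain i w : (X `*` [set: R]) (x i w, y i w).
Proof. by split => //; exact: (x_domain model). Qed.

Lemma pair_law i A : measurable A ->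
  P ((fun w => (x i w, y i w)) @^-1` A) = law A.
Proof. by move=> mA; exact: (labeled_iid model).2. Qed.

Lemma measurable_fun_fst_domain (h : M.-tuple R -> R) : measurable_fun X h ->
  measurable_fun (X `*` [set: R]) (fun z => h z.1).
Proof.
move=> mh; apply: (measurable_comp mX _ mh) => [|//].
  by move=> _ [z [Xz _] <-].
exact: measurable_funTS.
Qed.

(** Each labelled pair has the law of a fresh draw, so the loss of a fixed function can be computed
    at any sample index [i]. *)
Lemma lossE i f : measurable_fun X f ->
  loss X law f = 'E_P[fun w => ((y i w - f (x i w)) ^+ 2)%R]%E.
Proof.
move=> mf; rewrite expectation.unlock /loss.
rewrite (ge0_integral_law (measurable_pair i) measurable_domainX
  (pair_domain i) (pair_law i))//; last first.
  by move=> z; rewrite lee_fin sqr_ge0.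
apply/measurable_EFinP/measurable_funX/measurable_funB.
  exact: measurable_funTS.
exact: measurable_fun_fst_domain.
Qed.

(** Finiteness of the diagonal entry of C is exactly square integrability of the feature. *)
Lemma feature_L2 i k : (fun w => phi k (x i w)) \in Lfun P 2%:E.
Proof.
apply: Lfun2P; first exact: measurable_input.
rewrite expectation.unlock ltey_eq; apply/orP; left.
under eq_integral do rewrite expr2.
apply: integrable_fin_num => //; apply/Lfun1_integrable.
exact: (Lfun1_law (measurable_pair i) measurable_domainX
  (pair_domain i) (pair_law i) (Cfin k k)).
Qed.

Lemma CmxE i k l :
  Cmx phi X law k l = fine 'E_P[fun w => (phi k (x i w) * phi l (x i w))%R]%E.
Proof.
rewrite mxE expectation.unlock; congr fine.
rewrite (integral_law (measurable_pair i) measurable_domainX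
  (pair_domain i) (pair_law i))//.
by have /integrableP[] := Cfin k l.
Qed.

Lemma measurable_linear_fun a : measurable_fun X (linear_fun phi a).
Proof. by apply: measurable_sum => k; exact: measurable_funM. Qed.

Lemma linear_fun_sub a b t :
  linear_fun phi a t - linear_fun phi b t = linear_fun phi (a - b) t.
Proof.
rewrite /linear_fun -sumrB; apply: eq_bigr => k _.
by rewrite !mxE mulrBl.
Qed.

Lemma linear_fun_L2 i a : (fun w => linear_fun phi a (x i w)) \in Lfun P 2%:E.
Proof.
rewrite (_ : (fun w => _) = \sum_k a k ord0 *: (fun w => phi k (x i w))).
  apply: rpred_sum => [|p1 k _]; first by rewrite lee1n.
  by apply: rpredZ; exact: feature_L2.
by apply/funext => w; rewrite fct_sumE.
Qed.

Lemma expectation_linear_fun_sqr i b :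
  'E_P[fun w => (linear_fun phi b (x i w) ^+ 2)%R]%E =
  (quad (Cmx phi X law) b)%:E.
Proof.
rewrite (_ : (fun w => _) = fun w => \sum_q (b q.1 ord0 * b q.2 ord0) *
    (phi q.1 (x i w) * phi q.2 (x i w))); last first.
  apply/funext => w; rewrite expr2 /linear_fun big_distrl /=.
  rewrite -(pair_bigA _ (fun k l => (b k ord0 * b l ord0) *
    (phi k (x i w) * phi l (x i w)))) /=.
  apply: eq_bigr => k _; rewrite big_distrr /=; apply: eq_bigr => l _.
  by rewrite mulrACA.
rewrite expectation_lin; last by move=> q; apply: Lfun1M; exact: feature_L2.
congr EFin; rewrite quadE pair_bigA /=; apply: eq_bigr => q _.
by rewrite (CmxE i) mulrC.
Qed.

(** The form is the expectation of a square; index 0 is an arbitrary sample point. *)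
Lemma quad_Cmx_ge0 b : 0 <= quad (Cmx phi X law) b.
Proof.
rewrite -lee_fin -(expectation_linear_fun_sqr 0).
by apply: expectation_ge0 => w; exact: sqr_ge0.
Qed.

Section best_approximation.
Variable a : 'cV[R]_d.
Hypothesis a_argmin :
  forall b, (loss X law (linear_fun phi a) <= loss X law (linear_fun phi b))%E.
Hypothesis a_fin : (loss X law (linear_fun phi a) < +oo)%E.

Definition resid i w : R := y i w - linear_fun phi a (x i w).

Definition best_loss : R := fine (loss X law (linear_fun phi a)).

Lemma measurable_resid i : measurable_fun setT (resid i).
Proof.
apply: measurable_funB; first exact: measurable_output.
exact: (measurable_input _ (measurable_linear_fun a)).
Qed.

Lemma resid_L2 i : resid i \in Lfun P 2%:E.
Proof.
apply: Lfun2P; first exact: measurable_resid.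
by rewrite -(lossE i)//; exact: measurable_linear_fun.
Qed.

Lemma expectation_resid_sqr i :
  'E_P[fun w => (resid i w ^+ 2)%R]%E = best_loss%:E.
Proof.
rewrite /best_loss (lossE i); last exact: measurable_linear_fun.
rewrite fineK//; apply: expectation_fin_num.
exact: (Lfun1M (resid_L2 i) (resid_L2 i)).
Qed.

(** Expands the square of the residual minus the perturbation [b]. The linear term collects the
    correlations of the residual with the features, which optimality of [a] will force to vanish. *)
Lemma loss_expand i b : loss X law (linear_fun phi (a + b)) =
  (best_loss - 2 * \sum_k b k ord0 *
     fine 'E_P[fun w => (resid i w * phi k (x i w))%R]%E +
   quad (Cmx phi X law) b)%:E.
Proof.
rewrite (lossE i); last exact: measurable_linear_fun.
have Lrp k : (fun w => resid i w * phi k (x i w)) \in Lfun P 1.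
  by apply: Lfun1M; [exact: resid_L2|exact: feature_L2].
rewrite (_ : (fun w => _) = ((fun w => resid i w ^+ 2) \+
    ((- 2) \o* fun w => \sum_k b k ord0 * (resid i w * phi k (x i w)))) \+
    (fun w => linear_fun phi b (x i w) ^+ 2)); last first.
  apply/funext => w /=.
  rewrite (_ : \sum_k _ = resid i w * linear_fun phi b (x i w)); last first.
    by rewrite mulr_sumr; apply: eq_bigr => k _; rewrite mulrCA.
  have -> : linear_fun phi (a + b) (x i w) =
      linear_fun phi a (x i w) + linear_fun phi b (x i w).
    have := linear_fun_sub (a + b) a (x i w).
    by rewrite [a + b - a]addrAC subrr add0r => <-; rewrite addrCA subrr addr0.
  by rewrite /resid; ring.
have Ls := Lfun1_sum (index_enum _) (fun k => b k ord0) Lrp.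
have Lr : (fun w => resid i w ^+ 2) \in Lfun P 1.
  exact: (Lfun1M (resid_L2 i) (resid_L2 i)).
have Ll : (fun w => linear_fun phi b (x i w) ^+ 2) \in Lfun P 1.
  exact: (Lfun1M (linear_fun_L2 i b) (linear_fun_L2 i b)).
rewrite expectationD//; last first.
  by apply: rpredD => //; exact: Lfun_scale.
rewrite expectationD//; last exact: Lfun_scale.
rewrite expectationZl// expectation_lin// expectation_resid_sqr.
by rewrite expectation_linear_fun_sqr -EFinM -!EFinD mulNr.
Qed.

(** First-order condition: moving [a] by t along the k-th axis changes the loss by t^2 q - 2 t c,
    where c is the correlation and q = C_kk. This is nonnegative for every t only if c = 0. *)
Lemma resid_orthogonal i k :
  'E_P[fun w => (resid i w * phi k (x i w))%R]%E = 0%E.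
Proof.
have Lrp : (fun w => resid i w * phi k (x i w)) \in Lfun P 1.
  by apply: Lfun1M; [exact: resid_L2|exact: feature_L2].
rewrite -[LHS]fineK; last exact: expectation_fin_num.
set c := fine _; congr EFin.
set q := Cmx phi X law k k.
have quad_delta t : quad (Cmx phi X law) (t *: delta_mx k ord0) = t ^+ 2 * q.
  rewrite quadE (bigD1 k)//= [X in _ + X]big1 ?addr0; last first.
    move=> j jk; rewrite big1// => l _.
    by rewrite !mxE (negbTE jk) /= mulr0 mul0r mulr0.
  rewrite (bigD1 k)//= [X in _ + X]big1 ?addr0; last first.
    by move=> j jk; rewrite !mxE (negbTE jk) /= !mulr0.
  rewrite -/q (_ : (t *: delta_mx k ord0) k ord0 = t) -?expr2 1?mulrC//.
  by rewrite !mxE !eqxx mulr1.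
have opt t : 0 <= t ^+ 2 * q - 2 * (t * c).
  have := a_argmin (a + t *: delta_mx k ord0).
  rewrite [in leRHS](loss_expand i) quad_delta (bigD1 k)//= big1; last first.
    by move=> j jk; rewrite !mxE (negbTE jk) /= mulr0 mul0r.
  rewrite -/c !mxE !eqxx /= mulr1 addr0.
  rewrite -[leLHS]fineK; last first.
    rewrite ge0_fin_numE//; apply: integral_ge0 => z _.
    by rewrite lee_fin sqr_ge0.
  by rewrite -/best_loss lee_fin; lra.
have q0 : 0 <= q.
  have := quad_Cmx_ge0 (1 *: delta_mx k ord0).
  by rewrite quad_delta expr1n mul1r.
have q1 : 0 < q + 1 by lra.
have q1n : q + 1 != 0 by rewrite gt_eqF.
(* The minimiser of [opt] is t = c / q; q + 1 avoids the case q = 0. *)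
have := opt (c / (q + 1)).
rewrite (_ : _ - _ = - (c ^+ 2 * (q + 2) / (q + 1) ^+ 2)); last by field.
rewrite oppr_ge0 pmulr_lle0 ?invr_gt0 ?exprn_gt0// pmulr_lle0; last by lra.
by move=> c2; apply/eqP; rewrite -sqrf_eq0 eq_le c2 sqr_ge0.
Qed.

(** Pythagoras: the cross term vanishes by orthogonality, so the excess loss is a quadratic form in
    the distance to [a]. *)
Lemma loss_linear_fun b : loss X law (linear_fun phi b) =
  (best_loss + quad (Cmx phi X law) (b - a))%:E.
Proof.
have {1}-> : b = a + (b - a) by rewrite addrC subrK.
rewrite (loss_expand 0) big1 ?mulr0 ?subr0// => k _.
by rewrite resid_orthogonal mulr0.
Qed.

(** Orthogonality to the constant feature is centring. *)
Lemma expectation_resid (k0 : 'I_d) i :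
  (forall t, X t -> phi k0 t = 1) -> 'E_P[resid i]%E = 0%E.
Proof.
move=> phi1; rewrite -(resid_orthogonal i k0); congr expectation.
apply/funext => w; rewrite phi1 ?mulr1//; exact: (x_domain model).
Qed.

Lemma pair_independent i j : i != j ->
  independent_pair P (fun w => (x i w, y i w)) (fun w => (x j w, y j w)).
Proof.
move=> ij A B mA mB.
(* Mutual independence is used on the two-element list of indices, with [A] assigned to [i] and [B]
   to every other index. *)
have := (labeled_iid model).1 [:: i; j] (fun k => if k == i then A else B).
rewrite /= inE ij => /(_ isT) iidP.
have {iidP} := iidP (fun k => _).
rewrite !big_cons big_nil mule1 eqxx eq_sym (negbTE ij) => <-; last first.
  by move=> k; case: ifP.
congr (P _); apply/seteqP; split=> w /=.
  move=> [wA wB] k; rewrite /= !inE => /orP[] /eqP->.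
    by rewrite eqxx.
  by rewrite eq_sym (negbTE ij).
move=> wAB; have := wAB i; have := wAB j.
by rewrite /= !inE !eqxx orbT eq_sym (negbTE ij) => /(_ isT) ? /(_ isT) ?.
Qed.

(** For distinct indices the residuals are functions of independent pairs, and both are centred. *)
Lemma resid_uncorrelated (k0 : 'I_d) i j :
  (forall t, X t -> phi k0 t = 1) ->
  'E_P[fun w => (resid i w * resid j w)%R]%E = (best_loss *+ (i == j))%:E.
Proof.
move=> phi1; have [<-|ij] := eqVneq i j.
  by rewrite mulr1n; exact: expectation_resid_sqr.
(* The residual as a function of the pair is measurable only over the domain; setting it to 0
   elsewhere makes it measurable everywhere without changing it on the sample. *)
pose h : M.-tuple R * R -> R :=
  (fun z => z.2 - linear_fun phi a z.1) \_ (X `*` [set: R]).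
have mh : measurable_fun setT h.
  apply/(measurable_restrictT _ measurable_domainX).
  apply: measurable_funB; first exact: measurable_funTS.
  exact: (measurable_fun_fst_domain (measurable_linear_fun a)).
have hE k : h \o (fun w => (x k w, y k w)) = resid k.
  by apply/funext => w; rewrite /= /h patchE mem_set//; exact: pair_domain.
have rL k : h \o (fun w => (x k w, y k w)) \in Lfun P 1.
  by rewrite hE; exact/Lfun21/resid_L2.
have [_] := independent_mul (measurable_pair i) (measurable_pair j)
  (pair_independent ij) mh mh (rL i) (rL j).
by rewrite !hE !(expectation_resid _ phi1) mul0e mulr0n.
Qed.

End best_approximation.
End population.

(** * Unbiasedness of the oracle estimator *)

Section unbiasedness.
Context dO (Omega : measurableType dO) (R : realType) (P : probability Omega R)
  (M d : nat) (X : set (M.-tuple R)) (phi : 'I_d -> M.-tuple R -> R)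
  (law : probability (M.-tuple R * R)%type R) (p : M.-tuple R * R -> R)
  (fstar : M.-tuple R -> R) (sigma2 : R) (x : nat -> Omega -> M.-tuple R)
  (xi y : nat -> Omega -> R) (x' : nat -> Omega -> M.-tuple R).
Hypothesis model : regression_model P X law x y x' p fstar xi sigma2.
Hypothesis mphi : forall k, measurable_fun X (phi k).
Hypothesis Cfin : forall k l, law.-integrable (X `*` setT)
  (fun z => (phi k z.1 * phi l z.1)%:E).
Variables (a : 'cV[R]_d) (k0 : 'I_d) (n : nat).
Hypothesis phi1 : forall t, X t -> phi k0 t = 1.
Hypothesis a_argmin :
  forall b, (loss X law (linear_fun phi a) <= loss X law (linear_fun phi b))%E.
Hypothesis dn : (d < n)%N.
Hypothesis gram_ae :
  {ae P, forall w, gram phi (labeled_inputs x n w) \in unitmx}.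
Hypothesis Vfin : forall k l,
  (fun w => invmx (Chat phi (labeled_inputs x n w)) k l) \in Lfun P 1%E.
Hypothesis risk_fin : risk P phi X law x y n \is a fin_num.
Hypothesis resid_indep :
  independent_pair P (residuals x y (linear_fun phi a) n)
    (fun w => mx_tuple (design phi (labeled_inputs x n w))).

Let F w := design phi (labeled_inputs x n w).
Let r w : 'cV[R]_n := \col_i tnth (residuals x y (linear_fun phi a) n w) i.
Let C := Cmx phi X law.
Let s2 := best_loss X phi law a.

Let n0 : (n%:R : R) != 0.
Proof. by rewrite pnatr_eq0 -lt0n (leq_ltn_trans _ dn). Qed.

(** If the smallest loss were infinite, every linear predictor would have infinite loss, and so
    would the risk. *)
Lemma best_loss_fin : (loss X law (linear_fun phi a) < +oo)%E.
Proof.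
rewrite ltey; apply/eqP => lossy; move: risk_fin.
rewrite /risk (_ : (\int[P]_w _)%E = +oo)%E//.
rewrite (eq_integral (cst +oo%E)) => [|w _].
  by rewrite integral_cst//= probability_setT mule1.
by apply/eqP; rewrite eq_le leey -lossy a_argmin.
Qed.

Let a_fin := best_loss_fin.

Lemma inputs_labeled_data w :
  inputs (labeled_data x y n w) = labeled_inputs x n w.
Proof. by apply: eq_from_tnth => i; rewrite !tnth_mktuple. Qed.

(** The data follow a linear model with parameter [a] and error [r]; least squares treats the two
    parts separately. *)
Lemma outputs_labeled_data w :
  outputs (labeled_data x y n w) = F w *m a + r w.
Proof.
apply/colP => i; rewrite !mxE !tnth_mktuple /=.
rewrite addrC -[LHS](subrK (linear_fun phi a (x i w))); congr (_ + _).
by apply: eq_bigr => k _; rewrite mxE tnth_mktuple mulrC.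
Qed.

Lemma measurable_design : mx_measurable F.
Proof.
move=> i k; rewrite (_ : (fun t => _) = fun w => phi k (x i w)).
  exact: (measurable_input model _ (mphi k)).
by apply/funext => w; rewrite mxE tnth_mktuple.
Qed.

Lemma measurable_residuals :
  measurable_fun setT (residuals x y (linear_fun phi a) n).
Proof.
apply/measurable_fun_tnthP => i /=.
rewrite (_ : _ \o _ = resid phi x y a i).
  exact: (measurable_resid model mphi).
by apply/funext => w; rewrite /= tnth_mktuple.
Qed.

Lemma measurable_residual_vector : mx_measurable r.
Proof.
move=> i j; under eq_fun do rewrite mxE.
exact: (measurableT_comp (measurable_tnth i) measurable_residuals).
Qed.

Lemma measurable_outputs :
  mx_measurable (fun w => outputs (labeled_data x y n w)).
Proof.
move=> i j; rewrite (_ : (fun w => _) = y i).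
  exact: (measurable_output model).
by apply/funext => w; rewrite mxE tnth_mktuple.
Qed.

(** [expectation_quad] with the coded design matrix as the independent variable, [Q] being composed
    with the decoding. *)
Lemma expectation_quad_resid (Q : 'M[R]_(n, d) -> 'M[R]_n) :
  mx_measurable (fun t => Q (tuple_mx t)) ->
  (forall A u, 0 <= quad (Q A) u) ->
  'E_P[fun w => quad (Q (F w)) (r w)]%E =
  'E_P[fun w => (s2 * \tr (Q (F w)))%R]%E.
Proof.
move=> mQ Q0.
have := expectation_quad measurable_residuals
  (measurable_mx_tuple measurable_design) mQ resid_indep.
under eq_fun do rewrite mx_tupleK.
move=> /(_ s2) ->.
- by under eq_fun do rewrite mx_tupleK.
- by move=> t u; exact: Q0.
- move=> i; under eq_fun do rewrite tnth_mktuple.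
  exact: (resid_L2 model mphi a_fin).
- move=> i j; under eq_fun do rewrite !tnth_mktuple.
  exact: (resid_uncorrelated model mphi Cfin a_argmin a_fin i j phi1).
Qed.

Lemma fitted_loss_ge0 D : 0 <= fitted_loss phi (n := n) D.
Proof.
rewrite fitted_lossE mulr_ge0 ?invr_ge0 ?ler0n// quad_rss_mx.
by apply: sumr_ge0 => i _; exact: sqr_ge0.
Qed.

Lemma measurable_fitted_loss_data :
  measurable_fun setT (fun w => fitted_loss phi (labeled_data x y n w)).
Proof.
under eq_fun do rewrite fitted_lossE inputs_labeled_data.
apply: measurable_funM => //; apply: measurable_quad.
  exact: (measurable_rss_mx measurable_design).
exact: measurable_outputs.
Qed.

Lemma expectation_fitted_loss :
  'E_P[fun w => fitted_loss phi (labeled_data x y n w)]%E =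
  (n%:R^-1 * (n%:R - d%:R) * s2)%:E.
Proof.
pose Q (A : 'M[R]_(n, d)) := (n%:R^-1)%:M *m rss_mx A.
have QE A u : quad (Q A) u = n%:R^-1 * quad (rss_mx A) u.
  by rewrite /Q mul_scalar_mx /quad -scalemxAr -scalemxAl mxE.
(* The space is arbitrary because [Q] is needed both along the random design on [Omega] and along
   the decoding map on tuples. *)
have mQ dT (T' : measurableType dT) (G : T' -> 'M[R]_(n, d)) :
    mx_measurable G -> mx_measurable (fun t => Q (G t)).
  move=> mG; apply: mx_measurableM; first exact: mx_measurable_cst.
  exact: measurable_rss_mx.
have Q0 A u : 0 <= quad (Q A) u.
  rewrite QE mulr_ge0 ?invr_ge0 ?ler0n// quad_rss_mx.
  by apply: sumr_ge0 => i _; exact: sqr_ge0.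
(* Where the Gram matrix is invertible, the residual matrix kills the part [F w *m a] of the
   outputs, so the fitted loss is a form in [r] alone. *)
transitivity ('E_P[fun w => quad (Q (F w)) (r w)])%E.
  rewrite expectation.unlock; apply: ge0_ae_eq_integral => //.
  - exact/measurable_EFinP/measurable_fitted_loss_data.
  - apply/measurable_EFinP/measurable_quad.
      exact: (mQ _ _ _ measurable_design).
    exact: measurable_residual_vector.
  - by move=> w _; rewrite lee_fin fitted_loss_ge0.
  - by move=> w _; rewrite lee_fin.
  - apply: filterS gram_ae => w uF _ /=; congr EFin.
    rewrite fitted_lossE inputs_labeled_data QE !quad_rss_mx; congr (_ * _).
    apply: eq_bigr => i _; rewrite outputs_labeled_data mulmxDr mulmxA.
    by rewrite resid_mx_design// mul0mx add0r.
rewrite expectation_quad_resid//; last first.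
  exact: (mQ _ _ _ (measurable_tuple_mx (n:=d))).
(* The trace is almost surely the constant (n - d) / n. *)
rewrite -[RHS](expectation_cst P) expectation.unlock.
apply: ae_eq_integral => //.
  apply/measurable_EFinP/measurable_funM => //.
  by apply: mx_measurable_trace; exact: (mQ _ _ _ measurable_design).
  by apply/measurable_EFinP; exact: measurable_cst.
apply: filterS gram_ae => w uF _ /=; congr EFin.
by rewrite /Q mul_scalar_mx linearZ /= trace_rss_mx// mulrC.
Qed.

(** Almost surely the estimation error of least squares is [ols_mx (F w) *m r w], so the excess loss
    is a form in [r] whose matrix has the trace of C times the inverse Gram matrix. *)
Lemma riskE : risk P phi X law x y n =
  (s2 * (1 + n%:R^-1 * \tr (CVmx P phi X law x n)))%:E.
Proof.
pose Q (A : 'M[R]_(n, d)) := (ols_mx A)^T *m C *m ols_mx A.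
have mQ dT (T' : measurableType dT) (G : T' -> 'M[R]_(n, d)) :
    mx_measurable G -> mx_measurable (fun t => Q (G t)).
  move=> /measurable_ols_mx mG; apply: mx_measurableM => //.
  by apply: mx_measurableM; [exact: mx_measurableT|exact: mx_measurable_cst].
have QE A u : quad (Q A) u = quad C (ols_mx A *m u) by rewrite quad_conj.
have C0 b : 0 <= quad C b by exact: (quad_Cmx_ge0 model mphi Cfin).
have s20 : 0 <= s2.
  by apply: fine_ge0; apply: integral_ge0 => z _; rewrite lee_fin sqr_ge0.
have mols : mx_measurable (fun w => ols phi (labeled_data x y n w)).
  under eq_fun do rewrite olsE inputs_labeled_data.
  apply: mx_measurableM; last exact: measurable_outputs.
  exact: (measurable_ols_mx measurable_design).
transitivity (\int[P]_w (s2%:E + (quad (Q (F w)) (r w))%:E))%E.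
  apply: ge0_ae_eq_integral => //.
  - under eq_fun do rewrite (loss_linear_fun model mphi Cfin a_argmin a_fin).
    apply/measurable_EFinP/measurable_funD => //; apply: measurable_quad.
      exact: mx_measurable_cst.
    by apply: mx_measurableB => //; exact: mx_measurable_cst.
  - apply: emeasurable_funD => //; apply/measurable_EFinP/measurable_quad.
      exact: (mQ _ _ _ measurable_design).
    exact: measurable_residual_vector.
  - by move=> w _; apply: integral_ge0 => z _; rewrite lee_fin sqr_ge0.
  - by move=> w _; rewrite -EFinD lee_fin QE addr_ge0.
  - apply: filterS gram_ae => w uF _ /=.
    rewrite (loss_linear_fun model mphi Cfin a_argmin a_fin) -EFinD.
    congr ((_ + _)%:E); rewrite QE; congr quad.
    rewrite olsE inputs_labeled_data outputs_labeled_data mulmxDr mulmxA.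
    by rewrite ols_mxK// mul1mx addrC addKr.
rewrite ge0_integralD//; first last.
- apply/measurable_EFinP/measurable_quad.
    exact: (mQ _ _ _ measurable_design).
  exact: measurable_residual_vector.
- by move=> w _; rewrite lee_fin QE.
rewrite integral_cst//= probability_setT mule1 mulrDr mulr1 EFinD.
congr (_ + _)%E.
have := @expectation_quad_resid Q (mQ _ _ _ (measurable_tuple_mx (n:=d))).
rewrite [in LHS]expectation.unlock => ->; last by move=> A u; rewrite QE.
(* The trace is written as a combination, with deterministic coefficients, of the entries of the
   inverse of [Chat]. Each is integrable by [Vfin], and taking expectations entrywise produces V. *)
transitivity ('E_P[fun w => (\sum_q (s2 * n%:R^-1 * C q.1 q.2) *
    invmx (Chat phi (labeled_inputs x n w)) q.2 q.1)%R])%E.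
  rewrite expectation.unlock; apply: ae_eq_integral => //.
  - apply/measurable_EFinP/measurable_funM => //.
    by apply: mx_measurable_trace; exact: (mQ _ _ _ measurable_design).
  - apply/measurable_EFinP/measurable_sum => q; apply: measurable_funM => //.
    exact: (Lfun_measurable (Vfin _ _)).
  - apply: filterS gram_ae => w uF _ /=; congr EFin.
    rewrite trace_ols_mx// -/(gram phi (labeled_inputs x n w)).
    have uC : n%:R^-1 *: gram phi (labeled_inputs x n w) \in unitmx.
      by rewrite unitmxZ// unitfE invr_eq0.
    (* Inverting the scaled Gram matrix gives a factor n, which the coefficient [n%:R^-1]
       compensates. *)
    rewrite /Chat invmxZ// invrK.
    rewrite -(pair_bigA _ (fun k l => s2 * n%:R^-1 * C k l *
      (n%:R *: invmx (gram phi (labeled_inputs x n w))) l k)) /=.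
    rewrite /mxtrace mulr_sumr; apply: eq_bigr => k _.
    rewrite mxE mulr_sumr; apply: eq_bigr => l _.
    by rewrite [X in _ = _ * X]mxE; field.
rewrite expectation_lin//; congr EFin.
rewrite /CVmx mulrA.
rewrite -(pair_bigA _ (fun k l => s2 * n%:R^-1 * C k l *
  fine 'E_P[fun w => invmx (Chat phi (labeled_inputs x n w)) l k]%E)) /=.
rewrite /mxtrace mulr_sumr; apply: eq_bigr => k _.
rewrite mxE mulr_sumr; apply: eq_bigr => l _.
by rewrite [Vmx _ _ _ _ _ _]mxE mulrA.
Qed.

(** The denominator 1 - d/n of [inflation] cancels the factor (n - d) / n of the expected fitted
    loss. *)
Lemma risk_unbiased :
  fine (risk P phi X law x y n) = inflation n (CVmx P phi X law x n) *
    fine 'E_P[fun w => fitted_loss phi (labeled_data x y n w)]%E.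
Proof.
rewrite riskE expectation_fitted_loss /inflation /=.
have nd0 : (n%:R - d%:R : R) != 0 by rewrite subr_eq0 eqr_nat gtn_eqF.
by field; rewrite n0 nd0.
Qed.

End unbiasedness.

(** * Mean squared error *)

Section independent_factor.
Context dO d1 d2 (Omega : measurableType dO) (T1 : measurableType d1)
  (T2 : measurableType d2) (R : realType) (P : probability Omega R).
Variables (U : Omega -> T1) (V : Omega -> T2) (f : T1 -> R) (g : T2 -> R).
Hypotheses (mU : measurable_fun setT U) (mV : measurable_fun setT V).
Hypothesis UV : independent_pair P U V.
Hypotheses (mf : measurable_fun setT f) (mg : measurable_fun setT g).
Hypotheses (f2 : f \o U \in Lfun P 2%:E) (g2 : g \o V \in Lfun P 2%:E).

(** Expand the square around rho - t f(U). Independence factors the cross term and the last term;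
    the assumption that rho is the mean of t f(U) turns the f-part of the cross term into a
    covariance. *)
Lemma expectation_sqr_factor (t c rho : R) :
  rho = t * fine 'E_P[f \o U]%E ->
  ('E_P[fun w => ((rho - (t + c * g (V w)) * f (U w)) ^+ 2)%R] =
   'E_P[fun w => ((rho - t * f (U w)) ^+ 2)%R] +
   2%:E * ('E_P[g \o V] * c%:E) *
     covariance P (fun w => (t * f (U w))%R) (f \o U) +
   'E_P[fun w => (g (V w) ^+ 2)%R] * (c ^+ 2)%:E *
     'E_P[fun w => (f (U w) ^+ 2)%R])%E.
Proof.
move=> rhoE.
have f1 := Lfun21 f2; have g1 := Lfun21 g2.
have ff : (fun w => f (U w) ^+ 2) \in Lfun P 1 := Lfun1M f2 f2.
have gg : (fun w => g (V w) ^+ 2) \in Lfun P 1 := Lfun1M g2 g2.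
have tf1 : (fun w => t * f (U w)) \in Lfun P 1.
  by rewrite (_ : (fun w => _) = t *: (f \o U))//; apply: rpredZ.
have cf1 (k : R) : cst k \in Lfun P 1 by exact: Lfun_cst.
pose h u := (t * f u - rho) * f u.
(* The cross term of the expanded square is 2 c h(U) g(V). *)
have hE : h \o U = (t \o* (fun w => f (U w) ^+ 2)) \- (rho \o* (f \o U)).
  by apply/funext => w; rewrite /h /=; ring.
have h1 : h \o U \in Lfun P 1 by rewrite hE rpredB// Lfun_scale.
have mh : measurable_fun setT h.
  apply: measurable_funM => //; apply: measurable_funB => //.
  exact: measurable_funM.
have tff : (fun w => t * f (U w)) * (f \o U) \in Lfun P 1.
  rewrite (_ : _ * _ = t \o* (fun w => f (U w) ^+ 2)); first exact: Lfun_scale.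
  by apply/funext => w; rewrite /= fctE /=; ring.
have Eh : 'E_P[h \o U]%E = covariance P (fun w => t * f (U w)) (f \o U).
  rewrite covarianceE// hE expectationB ?Lfun_scale// !expectationZl//.
  rewrite (_ : _ * (f \o U) = t \o* (fun w => f (U w) ^+ 2)); last first.
    by apply/funext => w; rewrite /= fctE /=; ring.
  rewrite (_ : (fun w => t * f (U w)) = t \o* (f \o U)); last first.
    by apply/funext => w; rewrite /= mulrC.
  by rewrite !expectationZl// rhoE EFinM fineK ?expectation_fin_num.
rewrite -Eh.
have [hg1 hgE] := independent_mul mU mV UV mh mg h1 g1.
have mf2 : measurable_fun setT (fun u => f u ^+ 2) by exact: measurable_funX.
have mg2 : measurable_fun setT (fun u => g u ^+ 2) by exact: measurable_funX.
have [fg1 fgE] := independent_mul mU mV UV mf2 mg2 ff gg.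
have A1 : (fun w => (rho - t * f (U w)) ^+ 2) \in Lfun P 1.
  rewrite (_ : (fun w => _) =
      (cst (rho ^+ 2) \- ((2 * rho) \o* (fun w => t * f (U w)))) \+
      ((t ^+ 2) \o* (fun w => f (U w) ^+ 2))); last first.
    by apply/funext => w /=; ring.
  by rewrite rpredD ?rpredB// Lfun_scale.
rewrite (_ : (fun w => (rho - (t + c * g (V w)) * f (U w)) ^+ 2) =
  ((fun w => (rho - t * f (U w)) ^+ 2) \+
   ((2 * c) \o* ((h \o U) \* (g \o V)))) \+
  ((c ^+ 2) \o* (((fun u => f u ^+ 2) \o U) \* ((fun v => g v ^+ 2) \o V))));
  last first.
  by apply/funext => w /=; rewrite /h; ring.
rewrite expectationD ?rpredD ?Lfun_scale// expectationD ?Lfun_scale//.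
rewrite !expectationZl// hgE fgE.
congr (_ + _ + _)%E.
  by rewrite EFinM [in RHS](muleC 'E_P[g \o V]%E) !muleA muleAC.
by rewrite muleC -muleA muleC.
Qed.
End independent_factor.

(** * Measurability in the data when the features are controlled only on the input domain *)

Section measurable_data.
Context (R : realType) (M d : nat) (X : set (M.-tuple R)).
Hypothesis mX : measurable X.

Lemma measurable_in_domain n :
  measurable [set t : n.-tuple (M.-tuple R) | in_domain X t].
Proof.
rewrite (_ : [set t | _] =
    \bigcap_(i in [set: 'I_n]) ((@tnth _ _ ^~ i) @^-1` X)).
  apply: fin_bigcap_measurable => // i _.
  by rewrite -[_ @^-1` _]setTI; exact: measurable_tnth.
by apply/seteqP; split => [t tX i _|t tX i]; exact: tX.
Qed.

Variable phi : 'I_d -> M.-tuple R -> R.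
Hypothesis mphi : forall k, measurable_fun X (phi k).

(* [phi k] is only assumed measurable on [X], hence the restriction. *)
Lemma measurable_fitted_loss n :
  measurable_fun setT (fun D => fitted_loss (fun k => phi k \_ X) (n := n) D).
Proof.
under eq_fun do rewrite fitted_lossE.
apply: measurable_funM => //; apply: measurable_quad => [|i j].
  apply: measurable_rss_mx => i k; under eq_fun do rewrite mxE tnth_mktuple.
  apply: (measurableT_comp (f := phi k \_ X)).
    by apply/(measurable_restrictT _ mX).
  exact: (measurableT_comp measurable_fst (measurable_tnth i)).
under eq_fun do rewrite mxE.
exact: (measurableT_comp measurable_snd (measurable_tnth i)).
Qed.

Lemma fitted_loss_restrict n (D : n.-tuple (M.-tuple R * R)) :
  in_domain X (inputs D) ->
  fitted_loss (fun k => phi k \_ X) D = fitted_loss phi D.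
Proof.
move=> DX; rewrite !fitted_lossE.
suff -> : design (fun k => phi k \_ X) (inputs D) = design phi (inputs D) by [].
by apply/matrixP => i k; rewrite !mxE patchE mem_set//; exact: DX.
Qed.

(** A section of a jointly measurable map is measurable. For an estimator that ignores the labelled
    inputs, any section over the domain represents it as a function of the unlabelled data. *)
Lemma measurable_trace_section (H : matrix_estimator R M d) n n'
    (D0 : n.-tuple (M.-tuple R)) :
  measurable_estimator X H -> in_domain X D0 ->
  measurable_fun setT
    ((fun DU => \tr (H n n' D0 DU)) \_ [set t | in_domain X t]).
Proof.
move=> mH D0X; apply/(measurable_restrictT _ (measurable_in_domain (n:=n'))).
apply: measurable_sum => k.
have mdom : measurable [set D : n.-tuple (M.-tuple R) * n'.-tuple (M.-tuple R) |
    in_domain X D.1 /\ in_domain X D.2].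
  exact: (measurableX (measurable_in_domain (n:=n))
    (measurable_in_domain (n:=n'))).
apply: (measurable_comp mdom _ (mH n n' k k) (g := fun DU => (D0, DU))).
  by move=> _ [DU DUX <-].
by apply: measurable_funTS; exact: measurable_fun_pair.
Qed.

End measurable_data.

Theorem theorem4 (R : realType) (dO : measure_display)
    (Omega : measurableType dO) (P : probability Omega R)
    (M d : nat) (hd : (0 < d)%N)
    (X : set (M.-tuple R)) (phi : 'I_d -> M.-tuple R -> R)
    (law : probability (M.-tuple R * R)%type R) (p : M.-tuple R * R -> R)
    (fstar : M.-tuple R -> R) (sigma2 : R)
    (x : nat -> Omega -> M.-tuple R) (xi y : nat -> Omega -> R)
    (x' : nat -> Omega -> M.-tuple R)
    (model : regression_model P X law x y x' p fstar xi sigma2)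
    (phi1 : forall t, X t -> phi (Ordinal hd) t = 1)
    (fdstar : M.-tuple R -> R)
    (fdstar_argmin : is_argmin (model_class phi) (loss X law) fdstar)
    (Rhat : risk_estimator R M) (Hhat : matrix_estimator R M d)
    (Rhat_valid : valid_risk_estimator P phi X law x x' Rhat Hhat)
    (Hhat_unlabeled : unlabeled_only X Hhat)
    (n n' : nat)
    (standing : standing_assumptions P phi X law x y x' Hhat n n')
    (resid_indep : independent_pair P (residuals x y fdstar n)
       (fun w => mx_tuple (design phi (labeled_inputs x n w)))) :
  let Rstar : R := fine (risk P phi X law x y n) in
  let LD : Omega -> R := fun w => fitted_loss phi (labeled_data x y n w) in
  let RD : Omega -> R :=
    fun w => Rhat n n' (labeled_data x y n w) (unlabeled_data x' n' w) in
  let RDstar : Omega -> R :=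
    fun w => inflation n (CVmx P phi X law x n) * LD w in
  let b := bias P phi X law x x' Hhat n n' in
  let mse := MSE P phi X law x x' Hhat n n' in
  ('E_P[fun w => ((Rstar - RD w) ^+ 2)%R] =
     'E_P[fun w => ((Rstar - RDstar w) ^+ 2)%R]
     + 2%:E * (b * ((n%:R - d%:R)^-1)%:E) * covariance P RDstar LD
     + mse * ((n%:R - d%:R) ^- 2)%:E * 'E_P[fun w => (LD w ^+ 2)%R])%E.
Proof.
move=> Rstar LD RD RDstar b mse.
have dn := dim_lt_size standing.
have mphi : forall k, measurable_fun X (phi k) := phi_measurable standing.
have mX : measurable X := domain_measurable model.
have [[a _ aE] argmin] := fdstar_argmin.
rewrite -aE in resid_indep argmin.
have a_argmin c :
    (loss X law (linear_fun phi a) <= loss X law (linear_fun phi c))%E.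
  by apply: argmin; exists c.
have RstarE := risk_unbiased model mphi (C_finite standing) phi1 a_argmin dn
  (gram_unit standing) (V_finite standing) (risk_finite standing) resid_indep.
have [mH _ RhatE] := Rhat_valid.
have [HU HUE] := Hhat_unlabeled.
(* A probability space is nonempty; [w0] provides a reference labelled sample at which [Hhat] can be
   frozen. *)
have [w0 _] : exists w0 : Omega, True.
  apply: contrapT => noO; have := probability_setT P.
  rewrite (_ : [set: Omega] = set0) ?measure0; last first.
    by apply/seteqP; split=> w // _; apply: noO; exists w.
  by move=> /esym/eqP; rewrite onee_eq0.
have DX w : in_domain X (labeled_inputs x n w).
  by move=> i; rewrite tnth_mktuple; exact: (x_domain model).
have DUX w : in_domain X (unlabeled_data x' n' w).
  by move=> i; rewrite tnth_mktuple; exact: (x'_domain model).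
have DinX w : in_domain X (inputs (labeled_data x y n w)).
  by rewrite inputs_labeled_data.
pose f := fitted_loss (fun k => phi k \_ X) (n := n).
(* The trace error as a function of the unlabelled data alone: by [HUE] freezing the labelled inputs
   at [w0] does not change it on the sample. *)
pose g t := ((fun DU => \tr (Hhat n n' (labeled_inputs x n w0) DU)) \_
  [set t | in_domain X t]) t - \tr (CVmx P phi X law x n).
have fE : f \o labeled_data x y n = LD.
  by apply/funext => w; exact: fitted_loss_restrict.
have gE : g \o unlabeled_data x' n' = trace_error P phi X law x x' Hhat n n'.
  apply/funext => w; rewrite /g /trace_error /= patchE mem_set; last exact: DUX.
  by rewrite !HUE.
have mf : measurable_fun setT f by exact: measurable_fitted_loss.
have mg : measurable_fun setT g.
  by apply: measurable_funB => //; exact: measurable_trace_section.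
have mU : measurable_fun setT (labeled_data x y n).
  apply/measurable_fun_tnthP => i /=.
  rewrite (_ : _ \o _ = fun w => (x i w, y i w)).
    exact: (measurable_pair model).
  by apply/funext => w; rewrite /= tnth_mktuple.
have mV : measurable_fun setT (unlabeled_data x' n').
  apply/measurable_fun_tnthP => i /=.
  rewrite (_ : _ \o _ = x' i); first exact: (x'_measurable model).
  by apply/funext => w; rewrite /= tnth_mktuple.
have f2 : f \o labeled_data x y n \in Lfun P 2%:E.
  by rewrite fE; exact: fitted_loss_L2 standing.
have g2 : g \o unlabeled_data x' n' \in Lfun P 2%:E.
  rewrite gE (_ : trace_error _ _ _ _ _ _ _ _ _ =
    (fun w => \tr (Hhat n n' (labeled_inputs x n w) (unlabeled_data x' n' w))) -
    cst (\tr (CVmx P phi X law x n)))//.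
  apply: rpredB => [|p1|p1]; first by rewrite lee1n.
    exact: trace_L2 standing.
  exact: Lfun_cst.
have UV : independent_pair P (labeled_data x y n) (unlabeled_data x' n').
  by move=> A B; exact: (labeled_unlabeled_indep model).
(* Here t is T^*, c is 1 / (n - d) and rho is the risk; [RstarE] is the required unbiasedness. *)
have := @expectation_sqr_factor _ _ _ _ _ _ _ P _ _ f g mU mV
  UV mf mg f2 g2
  (inflation n (CVmx P phi X law x n)) (n%:R - d%:R)^-1 Rstar.
have fEw w : f (labeled_data x y n w) = LD w by rewrite -fE.
have gEw w :
    g (unlabeled_data x' n' w) = trace_error P phi X law x x' Hhat n n' w.
  by rewrite -gE.
rewrite fE gE => /(_ RstarE).
under eq_fun do rewrite fEw gEw.
under [X in (_ = 'E_P[X] + _ + _)%E -> _]eq_fun do rewrite fEw.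
under [X in (_ = _ + _ * covariance P X _ + _)%E -> _]eq_fun do rewrite fEw.
under [X in (_ = _ + 'E_P[X] * _ * _)%E -> _]eq_fun do rewrite gEw.
under [X in (_ = _ + _ * 'E_P[X])%E -> _]eq_fun do rewrite fEw.
rewrite exprVn => <-; congr expectation; apply/funext => w.
congr ((_ - _) ^+ 2).
(* It remains to check that T^ = T^* + (tr H^ - tr(CV)) / (n - d), which holds because (1/n) / (1 -
   d/n) = 1 / (n - d). *)
rewrite /RD RhatE// inputs_labeled_data; congr (_ * _).
rewrite /inflation /trace_error.
have n0 : (n%:R : R) != 0 by rewrite pnatr_eq0 -lt0n (leq_ltn_trans _ dn).
have nd0 : (n%:R - d%:R : R) != 0 by rewrite subr_eq0 eqr_nat gtn_eqF.
by field; rewrite n0 nd0.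
Qed.
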